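(* Consider a generalized linear mixed model for $y=(y_1,\dots,y_N)$ with finite parameter space $\Theta$ and true parameter vector $\theta_0\in\Theta$, and subsets of the data with clusters $y_{a,j}$, $1\le j\le m_a$, $1\le a\le b$, as described in the context. Suppose that: (A1) for each $1\le a\le b$, the vectors $y_{a,j}$, $1\le j\le m_a$, are independent, with $m_a\to\infty$ as $N\to\infty$; (A2) for every $\theta\in\Theta\setminus\{\theta_0\}$, $$\min_{1\le a\le b}\ \limsup_{N\to\infty}\ \frac{1}{m_a}\sum_{j=1}^{m_a}\mathrm{E}_{\theta_0}\left[\log\left\{\frac{p_\theta(y_{a,j})}{p_{\theta_0}(y_{a,j})}\right\}\right]<0;$$ (A3) for every $\theta\in\Theta\setminus\{\theta_0\}$, $$\frac{1}{m_a^2}\sum_{j=1}^{m_a}\mathrm{var}_{\theta_0}\left[\log\left\{\frac{p_\theta(y_{a,j})}{p_{\theta_0}(y_{a,j})}\right\}\right]\longrightarrow 0\quad\text{as } N\to\infty,\qquad 1\le a\le b.$$ Then $\mathrm{P}_{\theta_0}(\hat\theta=\theta_0)\to 1$ as $N\to\infty$, where $\hat\theta$ is the maximum likelihood estimator (MLE) of $\theta$.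
   Context: Generalized linear mixed model (GLMM). (i) Given a vector $u$ of random effects, responses $y_1,\dots,y_N$ are conditionally independent with conditional density, with respect to a $\sigma$-finite measure $\nu$, given by the exponential family $$f_i(y_i\mid u)=\exp\left[a_i^{-1}(\phi)\{y_i\xi_i-b(\xi_i)\}+c_i(y_i,\phi)\right],$$ where $\phi$ is a dispersion parameter (known in some cases), and $b(\cdot),a_i(\cdot),c_i(\cdot,\cdot)$ are known functions, continuously differentiable with respect to $\xi_i$ and $\phi$; the natural parameter $\xi_i$ is associated with the conditional mean $\mu_i=\mathrm{E}(y_i\mid u)$ according to the properties of the exponential family. (ii) $g(\mu_i)=x_i'\beta+z_i'u$, where $x_i,z_i$ are known vectors, $\beta$ is a vector of unknown parameters and $g(\cdot)$ is a link function. (iii) $u\sim N(0,G)$, where the covariance matrix $G$ may depend on a vector $\varphi$ of dispersion parameters. The vector of all unknown parameters is $\theta$, with parameter space $\Theta$ and true value $\theta_0$. The model (including the random effects and the known vectors) may vary with $N$, and asymptotics are as $N\to\infty$ with $\Theta$ and $\theta_0$ fixed. Subsets of the data. Let $b$ be a fixed positive integer (not the function $b(\cdot)$). For $1\le a\le b$, let $y_i^{(a)}$, $i=1,\dots,N_a$, be the $a$th subset of the data, and suppose there is a partition $\{1,\dots,N_a\}=\bigcup_{j=1}^{m_a}S_{a,j}$. Put $y_{a,j}=[y_i^{(a)}]_{i\in S_{a,j}}$. (The subsets, $N_a$, $m_a$ and the partitions may depend on $N$.) Let $p_\theta(y_{a,j})$ denote the (marginal) probability density function of $y_{a,j}$,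 with respect to $\nu$ (or the product measure induced by $\nu$ if $y_{a,j}$ is multivariate), when $\theta$ is the true parameter vector. Likewise $p_\theta(y)$ is the density of the full data $y=(y_i)_{1\le i\le N}$ under $\theta$. The independence in (A1) is under every $\theta\in\Theta$. $\mathrm{P}_\theta,\mathrm{E}_\theta,\mathrm{var}_\theta$ denote probability, expectation and variance when $\theta$ is the true parameter vector. The MLE $\hat\theta$ is the maximizer over $\Theta$ of the full-data likelihood $\theta\mapsto p_\theta(y)$. *)

(* Defs.v *)
From HB Require Import structures.
From mathcomp Require Import all_boot all_order all_algebra.
From mathcomp Require Import all_classical all_reals all_analysis.

Set Implicit Arguments.
Unset Strict Implicit.
Unset Printing Implicit Defensive.

Import Order.TTheory GRing.Theory Num.Theory.
Import numFieldNormedType.Exports.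

Local Open Scope classical_set_scope.
Local Open Scope ring_scope.

(* The n-fold product measure nu x ... x nu on n-tuples, by recursion on n
   through the library's binary product (cf. power_measure_box). *)
Section power_measure.
Local Open Scope ereal_scope.
Context d (T : measurableType d) (R : realType).

Section cons_measure.
Variables (n : nat) (nu : {sigma_finite_measure set T -> \bar R})
          (m : {sigma_finite_measure set (n.-tuple T) -> \bar R}).

Definition cons_pair (z : T * n.-tuple T) : n.+1.-tuple T :=
  [tuple of z.1 :: z.2].

Let measurable_cons_pair : measurable_fun [set: T * n.-tuple T] cons_pair.
Proof. exact: measurable_cons. Qed.

Definition cons_measure : set (n.+1.-tuple T) -> \bar R :=
  pushforward (nu \x m) cons_pair.

Let pre_measurable A : measurable A -> measurable (cons_pair @^-1` A).
Proof.
by move=> mA; rewrite -[X in measurable X]setTI; exact: measurable_cons_pair.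
Qed.

Let cons_measure0 : cons_measure set0 = 0.
Proof. by rewrite /cons_measure /pushforward preimage_set0 measure0. Qed.

Let cons_measure_ge0 A : 0 <= cons_measure A.
Proof. exact: measure_ge0. Qed.

Let cons_measure_sigma_additive : semi_sigma_additive cons_measure.
Proof.
move=> F mF tF mUF; rewrite /cons_measure /pushforward preimage_bigcup.
apply: measure_semi_sigma_additive.
- by move=> k; exact: pre_measurable.
- apply/trivIsetP => /= i j _ _ ij; rewrite -preimage_setI.
  by move/trivIsetP : tF => /(_ _ _ _ _ ij) ->//; rewrite preimage_set0.
- by rewrite -preimage_bigcup; exact: pre_measurable.
Qed.

HB.instance Definition _ := isMeasure.Build _ _ _ cons_measure
  cons_measure0 cons_measure_ge0 cons_measure_sigma_additive.

Let cons_measure_sigma_finite : sigma_finite setT cons_measure.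
Proof.
have /sigma_finiteP[F [TF ndF Foo]] := sigma_finiteT nu.
have /sigma_finiteP[G [TG ndG Goo]] := sigma_finiteT m.
exists (fun k => [set t : n.+1.-tuple T |
                   F k (thead t) /\ G k [tuple of behead t]]).
  apply/seteqP; split=> // t _.
  have : [set: T] (thead t) by [].
  have : [set: n.-tuple T] [tuple of behead t] by [].
  rewrite TF TG => -[k _ Gk] [l _ Fl]; exists (maxn k l) => //=; split.
    by move: (thead t) Fl; exact/subsetPset/ndF/leq_maxr.
  by move: [tuple of behead t] Gk; exact/subsetPset/ndG/leq_maxl.
move=> k; have [mF Fk] := Foo k; have [mG Gk] := Goo k; split.
  rewrite (_ : mkset _ = (fun t : n.+1.-tuple T => thead t) @^-1` F k `&`
      (fun t : n.+1.-tuple T => [tuple of behead t] : n.-tuple T) @^-1` G k)//.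
  apply: measurableI; rewrite -[X in measurable X]setTI.
    exact: (measurable_tnth ord0).
  exact: measurable_behead.
rewrite /cons_measure /pushforward [X in (nu \x m) X](_ : _ = F k `*` G k).
  by rewrite product_measure1E// lte_mul_pinfty// ge0_fin_numE.
have E (x : T) (t : n.-tuple T) :
    [tuple of behead (cons_pair (x, t))] = t :> n.-tuple T by exact/val_inj.
by apply/seteqP; split=> -[x t] /=; rewrite E {1}/cons_pair theadE.
Qed.

HB.instance Definition _ := Measure_isSigmaFinite.Build _ _ _ cons_measure
  cons_measure_sigma_finite.

End cons_measure.

Fixpoint power_measure (nu : {sigma_finite_measure set T -> \bar R}) n :
    {sigma_finite_measure set (n.-tuple T) -> \bar R} :=
  if n is n'.+1 then cons_measure nu (power_measure nu n')
  else dirac [tuple].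

Lemma power_measure_box (nu : {sigma_finite_measure set T -> \bar R}) n
    (A : 'I_n -> set T) : (forall i, measurable (A i)) ->
  power_measure nu n [set t | forall i, A i (tnth t i)] = \prod_(i < n) nu (A i).
Proof.
elim: n A => [|n IH] A mA /=.
  by rewrite big_ord0 diracE mem_set// => -[].
rewrite big_ord_recl -IH// /cons_measure /pushforward.
rewrite -product_measure1E//; last first.
  rewrite (_ : mkset _ =
      \bigcap_(i in [set: 'I_n]) ((@tnth n T)^~ i @^-1` A (lift ord0 i))).
    apply: fin_bigcap_measurable; first exact: finite_finset.
    by move=> i _; rewrite -[X in measurable X]setTI; exact: measurable_tnth.
  by apply/seteqP; split => t /= h i => [_|]; apply: h.
congr ((_ \x _) _); apply/seteqP; split=> -[x t]/=.
  move=> h; split=> [|i]; first by have := h ord0; rewrite tnth0.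
  by have := h (lift ord0 i); rewrite tnthS.
by move=> [h0 h] i; case: (unliftP ord0 i) => [j|] ->; rewrite ?tnthS ?tnth0.
Qed.

End power_measure.

(* f is a version of the density of law; nothing selects a particular version. *)
Definition is_pdf d (T : measurableType d) (R : realType)
    (mu law : set T -> \bar R) (f : T -> R) :=
  [/\ measurable_fun setT f,
      forall t, 0 <= f t &
      forall A, measurable A -> law A = (\int[mu]_(t in A) (f t)%:E)%E].

Definition mutually_independent d (T : measurableType d) (R : realType)
    (P : probability T R) (I : finType) d' (E : I -> measurableType d')
    (X : forall i, T -> E i) :=
  forall (J : {set I}) (A : forall i, set (E i)),
    (forall i, measurable (A i)) ->
    P (\bigcap_(i in [set` J]) (X i @^-1` A i)) =
      (\prod_(i in J) P (X i @^-1` A i))%E.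

Section gaussian_vector.
Context {R : realType}.

Definition col_of_tuple n (t : n.-tuple R) : 'cV[R]_n := \col_k tnth t k.

Definition covariance_matrix n (G : 'M[R]_n) :=
  G^T = G /\ forall t : 'cV[R]_n, 0 <= (t^T *m G *m t) 0 0.

(* Centred normal law of variance v; normal_prob is not the point mass when its
   standard deviation is 0. *)
Definition normal_var (v : R) : set R -> \bar R :=
  if v == 0 then dirac (0 : R) else normal_prob 0 (Num.sqrt v).

(* X ~ N(0, G), singular G allowed: every t'X is N(0, t'Gt). *)
Definition gaussian_vector d (T : measurableType d) (P : probability T R) n
    (X : T -> n.-tuple R) (G : 'M[R]_n) :=
  covariance_matrix G /\
  forall (t : 'cV[R]_n) (A : set R), measurable A ->
    P [set w | A ((t^T *m col_of_tuple (X w)) 0 0)] =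
      normal_var ((t^T *m G *m t) 0 0) A.

End gaussian_vector.

(* theta = (beta, phi, varphi): regression coefficients, dispersion parameter
   of the exponential family, dispersion parameters of G.  A known phi is a
   coordinate that is constant on the parameter space. *)
Definition param (R : realType) (p q : nat) : Type :=
  ('cV[R]_p * R * 'cV[R]_q)%type.
Definition par_beta (R : realType) p q (theta : param R p q) : 'cV[R]_p :=
  theta.1.1.
Definition par_phi (R : realType) p q (theta : param R p q) : R :=
  theta.1.2.
Definition par_varphi (R : realType) p q (theta : param R p q) : 'cV[R]_q :=
  theta.2.

Section glmm.
Context {R : realType}.

Definition C1_on (D : set R) (h : R -> R) :=
  forall t, D t -> derivable h t 1 /\ {for t, continuous (derive1 h)}.

Definition expfam_pdf (a b : R -> R) (c : R -> R -> R) (phi xi y : R) : R :=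
  expR ((a phi)^-1 * (y * xi - b xi) + c y phi).

Record glmm (p q : nat) (Theta : set (param R p q)) (N : nat) := Glmm {
  glmm_display : measure_display ;
  glmm_space : measurableType glmm_display ;
  glmm_prob : param R p q -> probability glmm_space R ;
  glmm_dimu : nat ;
  glmm_u : {mfun glmm_space >-> glmm_dimu.-tuple R} ;
  glmm_y : {mfun glmm_space >-> N.-tuple R} ;

  glmm_nu : {sigma_finite_measure set R -> \bar R} ;
  (* Open domains of the natural and of the dispersion parameter: b, a_i, c_i
     are total here, but e.g. b is only smooth on ]-oo, 0[ for the gamma law. *)
  glmm_Xi : set R ;
  glmm_Phi : set R ;
  glmm_a : 'I_N -> R -> R ;
  glmm_b : R -> R ;
  glmm_c : 'I_N -> R -> R -> R ;
  (* xi_i as a function of theta and u *)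
  glmm_xi : 'I_N -> param R p q -> glmm_dimu.-tuple R -> R ;
  glmm_link : R -> R ;
  glmm_x : 'I_N -> 'cV[R]_p ;
  glmm_z : 'I_N -> 'cV[R]_glmm_dimu ;
  glmm_G : 'cV[R]_q -> 'M[R]_glmm_dimu ;

  glmm_pdf i theta u y :=
    expfam_pdf (glmm_a i) glmm_b (glmm_c i) (par_phi theta)
               (glmm_xi i theta u) y ;
  glmm_mean i theta u := \int[glmm_nu]_y (y * glmm_pdf i theta u y) ;

  glmm_open : open glmm_Xi /\ open glmm_Phi ;
  glmm_C1b : C1_on glmm_Xi glmm_b ;
  glmm_C1a : forall i, C1_on glmm_Phi (glmm_a i) ;
  glmm_C1c : forall i y, C1_on glmm_Phi (glmm_c i y) ;
  glmm_a_neq0 : forall i phi, glmm_Phi phi -> glmm_a i phi != 0 ;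
  glmm_c_meas : forall i phi, glmm_Phi phi ->
    measurable_fun setT (fun y => glmm_c i y phi) ;
  glmm_phi_dom : forall theta, Theta theta -> glmm_Phi (par_phi theta) ;
  glmm_xi_meas : forall i theta, Theta theta ->
    measurable_fun setT (glmm_xi i theta) ;

  (* given u, y_i has conditional density f_i (. | u) with respect to nu *)
  glmm_cond_pdf : forall theta, Theta theta ->
    forall i (A : set R) (B : set (glmm_dimu.-tuple R)),
    measurable A -> measurable B ->
    glmm_prob theta [set w | A (tnth (glmm_y w) i) /\ B (glmm_u w)] =
      (\int[glmm_prob theta]_(w in glmm_u @^-1` B)
         \int[glmm_nu]_(y in A) (glmm_pdf i theta (glmm_u w) y)%:E)%E ;
  (* given u, the y_i are independent *)
  glmm_cond_indep : forall theta, Theta theta ->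
    forall (A : 'I_N -> set R) (B : set (glmm_dimu.-tuple R)),
    (forall i, measurable (A i)) -> measurable B ->
    glmm_prob theta
        [set w | (forall i, A i (tnth (glmm_y w) i)) /\ B (glmm_u w)] =
      (\int[glmm_prob theta]_(w in glmm_u @^-1` B)
         \prod_(i < N)
           \int[glmm_nu]_(y in A i) (glmm_pdf i theta (glmm_u w) y)%:E)%E ;
  (* mu_i = E(y_i | u) exists, mu_i = b'(xi_i), g(mu_i) = x_i'beta + z_i'u;
     only almost surely, these being relations between functions of u *)
  glmm_linear_predictor : forall theta, Theta theta ->
    {ae glmm_prob theta, forall w, forall i,
      let u := glmm_u w in
      [/\ glmm_Xi (glmm_xi i theta u),
          glmm_nu.-integrable setT (fun y => (y * glmm_pdf i theta u y)%:E),
          glmm_mean i theta u = derive1 glmm_b (glmm_xi i theta u) &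
          glmm_link (glmm_mean i theta u) =
            ((glmm_x i)^T *m par_beta theta +
             (glmm_z i)^T *m col_of_tuple u) 0 0]} ;
  glmm_u_normal : forall theta, Theta theta ->
    gaussian_vector (glmm_prob theta) glmm_u (glmm_G (par_varphi theta))
}.

End glmm.

(* A subset of the data indices 'I_N, listed as cl_index, together with a
   partition of its positions into nonempty blocks. *)
Record clustering (N : nat) := Clustering {
  cl_size : nat ;
  cl_index : 'I_cl_size -> 'I_N ;
  cl_count : nat ;
  cl_block : 'I_cl_count -> {set 'I_cl_size} ;
  cl_index_inj : injective cl_index ;
  cl_cover : forall i, exists j, i \in cl_block j ;
  cl_disjoint : forall i j k, i \in cl_block j -> i \in cl_block k -> j = k ;
  cl_nonempty : forall j, exists i, i \in cl_block j
}.

Section clusters.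
Context {R : realType} {p q : nat} {Theta : set (param R p q)} {N : nat}.
Variables (M : glmm Theta N) (C : clustering N).

Definition cl_dim (j : 'I_(cl_count C)) : nat := #|cl_block j|.

(* the vector y_{a,j} *)
Definition cl_y (j : 'I_(cl_count C)) (w : glmm_space M) : (cl_dim j).-tuple R :=
  [tuple tnth (glmm_y M w) (cl_index (enum_val k)) | k < cl_dim j].

(* ln is 0 on nonpositive reals; the densities of a GLMM are positive almost
   surely, so that this convention is immaterial. *)
Definition cl_log_ratio (f : forall j, param R p q -> (cl_dim j).-tuple R -> R)
    (theta theta0 : param R p q) (j : 'I_(cl_count C)) (w : glmm_space M) : R :=
  ln (f j theta (cl_y j w) / f j theta0 (cl_y j w)).

End clusters.
Arguments cl_y {R p q Theta N} M {C} j w.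
Arguments cl_log_ratio {R p q Theta N} M {C} f theta theta0 j w.

(* Ties are broken arbitrarily, but measurably, so that the law of est is
   defined. *)
Definition is_mle {R : realType} {p q N : nat} (Theta : set (param R p q))
    (L : param R p q -> N.-tuple R -> R) (est : N.-tuple R -> param R p q) :=
  (forall y, Theta (est y) /\
     forall theta, Theta theta -> L theta y <= L (est y) y)
  /\ (forall theta, Theta theta -> measurable [set y | est y = theta]).

(* Main.v *)
Require Import Defs.
From HB Require Import structures.
From mathcomp Require Import all_boot all_order all_algebra.
From mathcomp Require Import all_classical all_reals all_analysis.
From mathcomp Require Import measurable_realfun lra.

Set Implicit Arguments.
Unset Strict Implicit.
Unset Printing Implicit Defensive.

Import Order.TTheory GRing.Theory Num.Theory.
Import numFieldNormedType.Exports.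

Local Open Scope classical_set_scope.
Local Open Scope ring_scope.

(** Fix a wrong parameter theta.  It is enough that, under theta0, the event
    that theta is at least as likely as theta0 given the full data has vanishing
    probability: there are finitely many wrong parameters, and the maximum
    likelihood estimator can equal theta only on that event.

    Full-data likelihoods are out of reach, because all the y_i may be
    dependent.  The argument is to compare them through one subset of the data
    whose clusters are independent.  Choose the subset for which the average
    expected log-ratio of cluster densities stays below some - 2 eta, let m be
    its number of clusters, and let D be the event that the log-ratios of the
    clusters sum to at most - eta m.

    - Under theta0, D has probability close to 1: Chebyshev's inequality bounds
      the probability of its complement by eta^-2 times the sum of the variances
      over m^2 ([sum_deviation]).
    - On the event that f theta0 <= f theta, full-data probabilities under
      theta0 are at most those under theta ([likelihood_order_prob_le]).  So the
      part of that event inside D has theta0-probability at most the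
      theta-probability of D.  This change of measure replaces any analysis of
      the full likelihood.
    - Under theta, D is exponentially unlikely: exp of minus the sum of the
      log-ratios is a product of independent inverse likelihood ratios, each of
      theta-expectation at most 1, so Markov's inequality gives exp (- eta m)
      ([independent_chernoff], [integral_inverse_ratio_le1]).

    The two bounds are added in [likelihood_order_bound] and both tend to 0.

    One point is specific to the model.  Since ln is 0 outside the positive
    reals, an inverse likelihood ratio could have expectation above 1 if the
    theta0-density of a cluster vanished with positive theta-probability.  It
    does not: the conditional densities of an exponential family are positive,
    so the law of y is a mixture of positive densities, hence dominates the product
    measure, hence every other law of the model ([mixture_dominates],
    [glmm_null]). *)

(** * Integration against weights and densities *)

Lemma measurable_preimage d d' (T : measurableType d) (E : measurableType d')
    (X : T -> E) (A : set E) :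
  measurable_fun setT X -> measurable A -> measurable (X @^-1` A).
Proof. by move=> mX mA; rewrite -[X in measurable X]setTI; apply: mX. Qed.

Lemma measurable_fun_bigprod d (T : measurableType d) (R : realType) (I : Type)
    (s : seq I) (J : pred I) (g : I -> T -> R) :
  (forall i, measurable_fun setT (g i)) ->
  measurable_fun setT (fun w => \prod_(i <- s | J i) g i w).
Proof.
move=> mg; elim: s => [|i s IH].
  by under eq_fun do rewrite big_nil; exact: measurable_cst.
under eq_fun do rewrite big_cons.
by case: (J i) => //; exact: measurable_funM.
Qed.

Section weighted_image.
Local Open Scope ereal_scope.
Context {R : realType}.
Import HBNNSimple.

(** The right-hand side sees the weight h only through its integrals over
    preimages under X.  Two weighted spaces that agree on those integrals thus
    integrate every nonnegative function of X alike. *)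
Lemma weighted_integral_lim d1 d (T : measurableType d1) (E : measurableType d)
    (mu : {measure set T -> \bar R}) (X : T -> E) (h : T -> R) (g : E -> \bar R)
    (mg : measurable_fun [set: E] g) :
  measurable_fun setT X -> measurable_fun setT h -> (forall x, 0 <= h x)%R ->
  (forall x, 0 <= g x) ->
  \int[mu]_x ((h x)%:E * g (X x)) =
  limn (fun n => \sum_(r \in range (nnsfun_approx measurableT mg n))
    (r%:E * \int[mu]_(x in X @^-1` (nnsfun_approx measurableT mg n @^-1` [set r]))
       (h x)%:E)).
Proof.
move=> mX mh h0 g0; set gn := nnsfun_approx measurableT mg.
have mhE : measurable_fun setT (EFin \o h) by exact/measurable_EFinP.
transitivity (limn (fun n => \int[mu]_x ((h x)%:E * (gn n (X x))%:E))).
  rewrite -monotone_convergence//; last 3 first.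
  - move=> n; apply: emeasurable_funM => //; apply/measurable_EFinP.
    exact: measurableT_comp.
  - by move=> n x _; rewrite mule_ge0// lee_fin.
  - move=> x _ a b ab; rewrite lee_wpmul2l ?lee_fin//.
    exact/lefP/nd_nnsfun_approx.
  apply: eq_integral => x _; apply/esym/cvg_lim => //; apply: cvgeZl => //.
  exact: cvg_nnsfun_approx.
apply: congr_lim; apply/funext => n.
have mpre r : measurable (X @^-1` (gn n @^-1` [set r])).
  exact: measurable_preimage.
have mterm r : measurable_fun setT (fun x => (r * \1_(gn n @^-1` [set r]) (X x))%:E).
  apply/measurable_EFinP; apply: measurable_funM => //.
  have mi : measurable_fun setT (\1_(gn n @^-1` [set r]) : E -> R).
    exact: measurable_indic.
  exact: measurableT_comp mi mX.
transitivity (\int[mu]_x (\sum_(r \in range (gn n))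
    ((h x)%:E * (r * \1_(gn n @^-1` [set r]) (X x))%:E))).
  apply: eq_integral => x _.
  rewrite -ge0_mule_fsumr; last by move=> r; exact: nnfun_muleindic_ge0.
  by rewrite fsumEFin// -fimfunE.
rewrite ge0_integral_fsum//; last 2 first.
- by move=> r; exact: emeasurable_funM.
- move=> r x _; apply: mule_ge0; first by rewrite lee_fin.
  exact: nnfun_muleindic_ge0.
apply: eq_fsbigr => r; rewrite inE => -[t _ tr].
rewrite [in RHS]integral_mkcond -ge0_integralZl//; last 3 first.
- by apply/(measurable_restrictT _ (mpre r)); exact: measurable_funTS.
- by move=> x _; apply: erestrict_ge0 => y _; rewrite lee_fin.
- by rewrite lee_fin -tr.
apply: eq_integral => x _; rewrite patchE indicE.
have -> : (X x \in gn n @^-1` [set r]) = (x \in X @^-1` (gn n @^-1` [set r])).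
  by apply/idP/idP; rewrite !inE.
by case: ifPn => _; rewrite ?mulr1 ?mulr0 ?mule0 // muleC.
Qed.

(** Used both for changes of variables (a unit weight on one side, a density on
    the other) and to factor out an independent variable (a constant weight on
    one side). *)
Lemma eq_weighted_integral d1 d2 d (T1 : measurableType d1)
    (T2 : measurableType d2) (E : measurableType d)
    (mu1 : {measure set T1 -> \bar R}) (mu2 : {measure set T2 -> \bar R})
    (X1 : T1 -> E) (X2 : T2 -> E) (h1 : T1 -> R) (h2 : T2 -> R)
    (g : E -> \bar R) :
  measurable_fun setT X1 -> measurable_fun setT X2 ->
  measurable_fun setT h1 -> measurable_fun setT h2 ->
  (forall x, 0 <= h1 x)%R -> (forall x, 0 <= h2 x)%R ->
  (forall A, measurable A ->
    \int[mu1]_(x in X1 @^-1` A) (h1 x)%:E =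
    \int[mu2]_(x in X2 @^-1` A) (h2 x)%:E) ->
  measurable_fun setT g -> (forall x, 0 <= g x) ->
  \int[mu1]_x ((h1 x)%:E * g (X1 x)) = \int[mu2]_x ((h2 x)%:E * g (X2 x)).
Proof.
move=> mX1 mX2 mh1 mh2 h10 h20 h12 mg g0.
rewrite (weighted_integral_lim _ mg)// (weighted_integral_lim _ mg)//.
by apply: congr_lim; apply/funext => n; apply: eq_fsbigr => r _; rewrite h12.
Qed.

Lemma integral_pdf d1 d (T : measurableType d1) (E : measurableType d)
    (mu : {measure set T -> \bar R}) (nu : {measure set E -> \bar R})
    (X : T -> E) (f : E -> R) (g : E -> \bar R) :
  measurable_fun setT X -> is_pdf nu (pushforward mu X) f ->
  measurable_fun setT g -> (forall x, 0 <= g x) ->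
  \int[mu]_x g (X x) = \int[nu]_t ((f t)%:E * g t).
Proof.
move=> mX [mf f0 fE] mg g0.
rewrite -(@eq_weighted_integral _ _ _ _ _ _ mu nu X idfun (cst 1%R) f)//.
  by apply: eq_integral => x _; rewrite mul1e.
  exact: measurable_id.
move=> A mA; rewrite preimage_id -(fE _ mA).
transitivity (\int[mu]_(x in X @^-1` A) cst 1 x); first by [].
rewrite integral_cst ?mul1e//.
exact: measurable_preimage.
Qed.

End weighted_image.

(** * Independent families *)

Section independence.
Local Open Scope ereal_scope.
Context d (T : measurableType d) (R : realType) (P : probability T R).
Context (I : finType) d' (E : I -> measurableType d') (X : forall i, T -> E i).
Hypothesis mX : forall i, measurable_fun setT (X i).
Hypothesis indX : mutually_independent P X.

(** For indicators this is the definition of independence.  General functions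
    are reached by replacing one indicator at a time: with the other factors as
    weight, the identity for all indicators of X k says that this weight
    integrates over events of X k like a constant, and [eq_weighted_integral]
    extends this from indicators to g k.  No product of the spaces E i is
    needed. *)
Lemma independent_integral_prod (g : forall i, E i -> R) :
  (forall i, measurable_fun setT (g i)) -> (forall i t, 0 <= g i t)%R ->
  (forall i, \int[P]_w (g i (X i w))%:E < +oo) ->
  \int[P]_w (\prod_i g i (X i w))%:E = \prod_i \int[P]_w (g i (X i w))%:E.
Proof.
(* s lists the indices whose factor need not be an indicator *)
suff claim (s : seq I) : forall g : forall i, E i -> R,
  (forall i, measurable_fun setT (g i)) -> (forall i t, 0 <= g i t)%R ->
  (forall i, \int[P]_w (g i (X i w))%:E < +oo) ->
  (forall i, i \notin s -> exists2 A, measurable A & g i = \1_A) ->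
  \int[P]_w (\prod_i g i (X i w))%:E = \prod_i \int[P]_w (g i (X i w))%:E.
  by move=> mg g0 gy; apply: (claim (enum I)) => // i; rewrite mem_enum.
have prodE (J : pred I) (x : I -> R) :
    ((\prod_(i | J i) x i)%:E = \prod_(i | J i) (x i)%:E).
  exact: (big_morph EFin EFinM erefl).
elim: s => [|k s IH] {}g mg g0 gy gind.
  pose A i := s2val (cid2 (gind i isT)).
  have mA i : measurable (A i) by rewrite /A; case: cid2.
  have gA i : g i = \1_(A i) by rewrite /A; case: cid2.
  have := indX [set: I]%SET mA.
  have mXA i : measurable (X i @^-1` A i).
    exact: measurable_preimage.
  rewrite (eq_bigl xpredT); last by move=> i; rewrite inE.
  rewrite (_ : P _ = \int[P]_w (\prod_i g i (X i w))%:E).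
    move=> ->; apply: eq_bigr => i _; rewrite gA.
    by rewrite -(setIT (X i @^-1` A i)) -integral_indic.
  rewrite -[X in P X]setIT -integral_indic//; last first.
    exact: fin_bigcap_measurable.
  apply: eq_integral => w _; congr EFin; rewrite indicE.
  have [wA|wA] := boolP (_ \in _).
    rewrite big1// => i _; rewrite gA indicE.
    by move: wA; rewrite inE => /(_ i); rewrite /= inE => wA; rewrite mem_set//; exact: wA.
  have [i wAi] : exists i, ~ A i (X i w).
    apply/existsNP => wAi; move/negP: wA; apply; rewrite inE => i _; exact: wAi.
  by rewrite (bigD1 i)//= gA indicE memNset// mul0r.
have gfin i : (fine (\int[P]_w (g i (X i w))%:E))%:E = \int[P]_w (g i (X i w))%:E.
  rewrite fineK// ge0_fin_numE ?gy// integral_ge0// => w _.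
  by rewrite lee_fin.
pose c := (\prod_(i | i != k) fine (\int[P]_w (g i (X i w))%:E))%R.
have cE : c%:E = \prod_(i | i != k) \int[P]_w (g i (X i w))%:E.
  by rewrite prodE; apply: eq_bigr => i _; rewrite gfin.
have c0 : (0 <= c)%R.
  apply: prodr_ge0 => i _; apply: fine_ge0; apply: integral_ge0 => w _.
  by rewrite lee_fin.
pose h w := (\prod_(i | i != k) g i (X i w))%R.
have mgX i : measurable_fun setT (fun w => g i (X i w)).
  by apply: (@measurableT_comp _ _ _ _ _ _ (g i) _ (X i)).
have mh : measurable_fun setT h.
  exact: measurable_fun_bigprod.
transitivity (\int[P]_w ((h w)%:E * (EFin \o g k) (X k w))).
  by apply: eq_integral => w _; rewrite (bigD1 k)//= mulrC EFinM.
rewrite (@eq_weighted_integral _ _ _ _ _ _ _ P P (X k) (X k) h (cst c))//=; first last.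
- by move=> t; rewrite lee_fin.
- exact/measurable_EFinP.
- move=> A mA.
  have mXA : measurable (X k @^-1` A).
    exact: measurable_preimage.
  have IA : \int[P]_w (\1_A (X k w))%:E = P (X k @^-1` A).
    by rewrite -[X in P X]setIT -integral_indic.
  have {IH} := IH (eqtype.dfwith g (\1_A : E k -> R)).
  rewrite (bigD1 k)//= eqtype.dfwith_in IA.
  rewrite (eq_bigr (fun i => \int[P]_w (g i (X i w))%:E)); last first.
    by move=> i ik; rewrite eqtype.dfwith_out// eq_sym.
  rewrite -cE integral_cst// muleC => <-.
  + rewrite integral_mkcond; apply: eq_integral => w _.
    rewrite (bigD1 k)//= eqtype.dfwith_in (eq_bigr (fun i => g i (X i w))); last first.
      by move=> i ik; rewrite eqtype.dfwith_out// eq_sym.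
    rewrite patchE indicE -/(h w).
    have -> : (X k w \in A) = (w \in X k @^-1` A) by apply/idP/idP; rewrite !inE.
    by case: ifPn => _; rewrite ?mul1r ?mul0r.
  + move=> i; case: eqtype.dfwithP => // {}i _; exact: mg.
  + move=> i; case: eqtype.dfwithP => // {}i _; exact: g0.
  + move=> i; case: eqtype.dfwithP => [|{}i _]; last exact: gy.
    by rewrite IA (le_lt_trans (probability_le1 _ _)) ?ltry.
  + move=> i; case: eqtype.dfwithP => [_|{}i ki is_]; first by exists A.
    by apply: gind; rewrite inE negb_or is_ andbT eq_sym.
- by move=> w; apply: prodr_ge0.
rewrite ge0_integralZl_EFin//; last 2 first.
- by move=> w _; rewrite lee_fin.
- exact/measurable_EFinP.
by rewrite (bigD1 k)//= -cE muleC.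
Qed.
End independence.

Lemma mutually_independent_pair d (T : measurableType d) (R : realType)
    (P : probability T R) (I : finType) d' (E : I -> measurableType d')
    (X : forall i, T -> E i) (i j : I) (A : set (E i)) (B : set (E j)) :
  mutually_independent P X -> i != j -> measurable A -> measurable B ->
  P (X i @^-1` A `&` X j @^-1` B) = (P (X i @^-1` A) * P (X j @^-1` B))%E.
Proof.
move=> indX ij mA mB.
pose F := eqtype.dfwith (eqtype.dfwith (fun k => [set: E k]) A) B.
have Fj : F j = B by rewrite /F eqtype.dfwith_in.
have Fi : F i = A by rewrite /F eqtype.dfwith_out ?eqtype.dfwith_in// eq_sym.
have mF k : measurable (F k).
  by rewrite /F; case: eqtype.dfwithP => // {}k _; case: eqtype.dfwithP.
have := indX [set i; j]%SET _ mF.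
rewrite big_setU1 ?inE//= big_set1 Fi Fj => <-; congr (P _).
apply/seteqP; split => w /=.
  by move=> [Aw Bw] k; rewrite /= !inE => /orP[]/eqP ->; rewrite ?Fi ?Fj.
move=> h; split; first by have := h i; rewrite /= Fi; apply; rewrite !inE eqxx.
by have := h j; rewrite /= Fj; apply; rewrite !inE eqxx orbT.
Qed.

(** * Deviations of sums of uncorrelated variables *)

Section second_moments.
Local Open Scope ereal_scope.
Context d (T : measurableType d) (R : realType) (P : probability T R).

(** The variance is defined through fine 'E_P[X], whatever that is when X is not
    integrable, so it is the second moment of X about some real number; its
    finiteness alone yields square integrability. *)
Lemma variance_lty_Lfun2 (X : T -> R) :
  measurable_fun setT X -> 'V_P[X] < +oo -> X \in Lfun P 2%:E.
Proof.
move=> mX VX; set c := fine 'E_P[X].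
have -> : X = ((X \- cst c) \+ cst c)%R by apply/funext => w /=; rewrite subrK.
rewrite rpredD ?lee1n//= => _; last by rewrite Lfun_cst.
have mY : measurable_fun setT (X \- cst c)%R.
  by apply: measurable_funB => //; exact: measurable_cst.
move: VX; rewrite /variance covariance.unlock -/c.
move: (X \- cst c)%R mY => Y mY VY.
rewrite inE; apply/andP; split; rewrite inE/=//.
rewrite /finite_norm Lnorm.unlock poweR_lty//.
move: VY; rewrite expectation.unlock; congr (_ < +oo); apply: eq_integral => w _.
by rewrite /= powR_mulrn// real_normK ?num_real// expr2.
Qed.

(** Independence makes the joint law a product measure, over which Fubini's
    theorem splits the expectation of the product. *)
Lemma independent_covariance0 (U V : {RV P >-> R}) :
  (U : T -> R) \in Lfun P 2%:E -> (V : T -> R) \in Lfun P 2%:E ->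
  (forall A B, measurable A -> measurable B ->
    P (U @^-1` A `&` V @^-1` B) = P (U @^-1` A) * P (V @^-1` B)) ->
  covariance P U V = 0.
Proof.
move=> U2 V2 UV.
have Pfin : P setT \is a fin_num := fin_num_measure P _ measurableT.
have U1 := Lfun_subset12 Pfin U2.
have V1 := Lfun_subset12 Pfin V2.
have UV1 := Lfun2_mul_Lfun1 U2 V2.
have mW : measurable_fun setT (fun w => (U w, V w)).
  exact: measurable_fun_pair.
pose W : {RV P >-> (R * R)%type} := mfun_Sub (mem_set mW).
pose xy (z : R * R) := (z.1 * z.2)%:E.
have mxy : measurable_fun setT xy.
  apply/measurable_EFinP; apply: measurable_funM; [exact: measurable_fst|exact: measurable_snd].
have lawW A : measurable A -> (distribution P U \x distribution P V) A = distribution P W A.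
  by move=> mA; exact: product_measure_unique.
have absdistr (Y : {RV P >-> R}) : (Y : T -> R) \in Lfun P 1 ->
    \int[distribution P Y]_y `|y%:E| = \int[P]_w `|(Y w)%:E| /\
    \int[P]_w `|(Y w)%:E| < +oo.
  move=> /Lfun1_integrable/integrableP[_ Yoo]; split=> //.
  by rewrite ge0_integral_distribution//; exact: measurableT_comp.
have meandistr (Y : {RV P >-> R}) : (Y : T -> R) \in Lfun P 1 ->
    \int[distribution P Y]_y y%:E = 'E_P[Y].
  move=> /Lfun1_integrable Y1.
  by rewrite expectation_def integral_distribution.
have idint (Y : {RV P >-> R}) : (Y : T -> R) \in Lfun P 1 ->
    (distribution P Y).-integrable setT (EFin : R -> \bar R).
  by move=> Y1; apply/integrableP; split=> //; case: (absdistr Y Y1) => ->.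
have ixy : (distribution P U \x distribution P V).-integrable setT xy.
  apply/integrable12ltyP => //=; rewrite /xy/=.
  rewrite (eq_integral (fun x : R => \int[P]_w `|(V w)%:E| * `|x%:E|)); last first.
    move=> x _; rewrite -(absdistr V V1).1 muleC -ge0_integralZl//; last first.
      exact: measurableT_comp.
    by apply: eq_integral => y _; rewrite -abseM.
  rewrite ge0_integralZl//; [|exact: measurableT_comp|exact: integral_ge0].
  rewrite (absdistr U U1).1 lte_mul_pinfty//; first exact: integral_ge0.
    by rewrite ge0_fin_numE ?(absdistr V V1).2// integral_ge0.
  exact: (absdistr U U1).2.
rewrite covarianceE//.
suff -> : 'E_P[U * V] = 'E_P[U] * 'E_P[V].
  by rewrite subee// fin_numM ?expectation_fin_num.
transitivity (\int[distribution P W]_z xy z).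
  rewrite integral_distribution//; last by apply/Lfun1_integrable.
  by rewrite unlock.
transitivity (\int[distribution P U \x distribution P V]_z xy z).
  by apply: eq_measure_integral => A mA _; apply: esym; exact: lawW.
rewrite -integral12_prod_meas1//= /fubini_F /xy/=.
rewrite (eq_integral (fun x : R => 'E_P[V] * x%:E)); last first.
  move=> x _; rewrite -(meandistr V V1) muleC -integralZl//; last exact: idint.
rewrite -(fineK (expectation_fin_num V1)).
rewrite integralZl//; last exact: idint.
by rewrite meandistr// muleC.
Qed.

Lemma covariance_suml (I : eqType) (s : seq I) (Z : I -> T -> R) (Y : T -> R) :
  (forall i, Z i \in Lfun P 2%:E) -> Y \in Lfun P 2%:E ->
  covariance P (\sum_(i <- s) Z i)%R Y = \sum_(i <- s) covariance P (Z i) Y.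
Proof.
move=> Z2 Y2; elim: s => [|i s IH]; first by rewrite !big_nil covariance_cst_l.
by rewrite !big_cons -IH -covarianceDl// rpred_sum// lee1n.
Qed.

Lemma variance_sum (I : eqType) (s : seq I) (Z : I -> T -> R) :
  uniq s -> (forall i, Z i \in Lfun P 2%:E) ->
  (forall i j, i != j -> covariance P (Z i) (Z j) = 0) ->
  'V_P[(\sum_(i <- s) Z i)%R] = \sum_(i <- s) 'V_P[Z i].
Proof.
move=> + Z2 Z0; elim: s => [|i s IH] /=; first by rewrite !big_nil variance_cst.
move=> /andP[is_ us]; rewrite !big_cons varianceD//; last first.
  by rewrite rpred_sum// lee1n.
rewrite IH// [covariance _ _ _](_ : _ = 0) ?mule0 ?adde0//.
rewrite covarianceC covariance_suml// big_seq big1//.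
by move=> j js; apply: Z0; apply: contraNneq is_ => <-.
Qed.

(** Chebyshev's inequality at distance eta m: the mean of the sum lies below
    - 2 eta m, so exceeding - eta m is a deviation of more than eta m. *)
Lemma sum_deviation (m : nat) (Z : 'I_m -> T -> R) (eta : R) :
  (0 < m)%N -> (0 < eta)%R -> (forall j, Z j \in Lfun P 2%:E) ->
  (forall i j, i != j -> covariance P (Z i) (Z j) = 0) ->
  (m%:R^-1)%:E * \sum_(j < m) 'E_P[Z j] <= (- (2 * eta))%:E ->
  P [set w | - (eta * m%:R) < \sum_(j < m) Z j w]%R <=
  (eta ^- 2)%:E * (((m%:R ^+ 2)^-1)%:E * \sum_(j < m) 'V_P[Z j]).
Proof.
move=> m0 eta0 Z2 Z0 EZ; have mR0 : (0 < m%:R :> R)%R by rewrite ltr0n.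
have Pfin : P setT \is a fin_num := fin_num_measure P _ measurableT.
pose S := (\sum_(j < m) Z j)%R.
have S2 : S \in Lfun P 2%:E by rewrite rpred_sum// lee1n.
have S1 := Lfun_subset12 Pfin S2.
have SE w : S w = (\sum_(j < m) Z j w)%R by rewrite /S fct_sumE.
have mS : measurable_fun setT S.
  by move: S2; rewrite inE => /andP[]; rewrite inE.
pose SX : {RV P >-> R} := mfun_Sub (mem_set mS).
have ES : 'E_P[S] = \sum_(j < m) 'E_P[Z j].
  rewrite /S -(big_map Z xpredT id) expectation_sum ?big_map//.
  by move=> _ /mapP[j _ ->]; exact: (Lfun_subset12 Pfin (Z2 j)).
have VS : 'V_P[S] = \sum_(j < m) 'V_P[Z j].
  by rewrite variance_sum// index_enum_uniq.
have etam : (0 < eta * m%:R)%R by rewrite mulr_gt0.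
have := chebyshev SX etam; rewrite /= VS exprMn invfM EFinM -muleA.
apply: le_trans; apply: le_measure; rewrite ?inE.
- rewrite [X in measurable X](_ : _ = S @^-1` `](- (eta * m%:R))%R, +oo[%classic); last first.
    by apply/seteqP; split => w /=; rewrite SE in_itv/= andbT.
  exact: measurable_preimage.
- rewrite [X in measurable X](_ : _ =
      (fun w : T => `|S w - fine 'E_P[S]|%R) @^-1` `[(eta * m%:R)%R, +oo[%classic); last first.
    by apply/seteqP; split => w /=; rewrite in_itv/= andbT.
  apply: measurable_preimage => //; apply: measurableT_comp => //.
  by apply: measurable_funB.
move=> w /=; rewrite -SE => Sw.
have : (fine 'E_P[S] <= - (2 * eta) * m%:R)%R.
  move: EZ; rewrite -ES -(fineK (expectation_fin_num S1)) -EFinM lee_fin.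
  by rewrite mulrC ler_pdivrMr.
rewrite -/S => ESle; apply: le_trans (ler_norm _).
by rewrite lerBrDr; nra.
Qed.

End second_moments.

(** * Product measures and mixtures of product densities *)

Section tuple_boxes.
Local Open Scope ereal_scope.
Context d (T : measurableType d) (R : realType) (n : nat).

Definition box (A : 'I_n -> set T) : set (n.-tuple T) :=
  [set t | forall i, A i (tnth t i)].

Lemma measurable_box (A : 'I_n -> set T) :
  (forall i, measurable (A i)) -> measurable (box A).
Proof.
move=> mA; rewrite (_ : box A =
    \bigcap_(i in [set: 'I_n]) ((@tnth n T)^~ i @^-1` A i)); last first.
  by apply/seteqP; split => t /= h i => [_|]; apply: h.
apply: fin_bigcap_measurable; first exact: finite_finset.
by move=> i _; apply: measurable_preimage => //; exact: measurable_tnth.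
Qed.

Definition measurable_boxes : set (set (n.-tuple T)) :=
  [set box A | A in [set A | forall i, measurable (A i)]].

Lemma measurable_tuple_boxes :
  @measurable _ (n.-tuple T) = <<s measurable_boxes >>.
Proof.
apply/seteqP; split.
  apply: smallest_sub; first exact: smallest_sigma_algebra.
  rewrite -bigcup_seq => C [i _ [B mB <-]].
  apply: sub_sigma_algebra.
  exists (fun j => if j == i then B else setT).
    by move=> j; case: ifP.
  apply/seteqP; split => t /=.
    by move=> /(_ i); rewrite eqxx.
  by move=> [_ Bt] j; case: eqP => [->|].
apply: smallest_sub; first exact: sigma_algebra_measurable.
by move=> _ [A mA <-]; exact: measurable_box.
Qed.

Lemma eq_measure_boxes (m1 m2 : {measure set (n.-tuple T) -> \bar R}) :
  m1 setT < +oo ->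
  (forall A, (forall i, measurable (A i)) -> m1 (box A) = m2 (box A)) ->
  forall C, measurable C -> m1 C = m2 C.
Proof.
move=> m1oo m12; apply: (measure_unique measurable_boxes (fun=> setT)).
- exact: measurable_tuple_boxes.
- move=> _ _ [A mA <-] [B mB <-]; exists (fun i => A i `&` B i).
    by move=> i; apply: measurableI; [exact: mA|exact: mB].
  apply/seteqP; split => t /=.
    by move=> AB; split=> i; have [] := AB i.
  by move=> [At Bt] i; split; [exact: At|exact: Bt].
- move=> _; exists (fun=> setT) => //.
  by apply/seteqP; split.
- by rewrite bigcup_const//; exists 0%N.
- by move=> _ [A mA <-]; exact: m12.
- by [].
Qed.

End tuple_boxes.

Section power_measure_integral.
Local Open Scope ereal_scope.
Context d (T : measurableType d) (R : realType).
Variable nu : {sigma_finite_measure set T -> \bar R}.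

Lemma integral_power_measure_prod n (g : 'I_n -> T -> R) :
  (forall i, measurable_fun setT (g i)) -> (forall i x, 0 <= g i x)%R ->
  \int[power_measure nu n]_t (\prod_(i < n) g i (tnth t i))%:E =
  \prod_(i < n) \int[nu]_x (g i x)%:E.
Proof.
elim: n g => [|n IH] g mg g0 /=.
  rewrite big_ord0 (eq_integral (cst 1)); last by move=> t _; rewrite big_ord0.
  by rewrite integral_cst// mul1e /= diracE mem_set.
have mprod k (f : 'I_k -> T -> R) : (forall i, measurable_fun setT (f i)) ->
    measurable_fun [set: k.-tuple T] (fun t => \prod_(i < k) f i (tnth t i))%R.
  move=> mf; apply: measurable_fun_bigprod => i.
  by apply: (measurableT_comp (mf i)); exact: measurable_tnth.
have mcons : measurable_fun setT (@cons_pair _ T n).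
  exact: measurable_cons.
set m := power_measure nu n.
pose F (t : n.+1.-tuple T) := (\prod_(i < n.+1) g i (tnth t i))%:E.
transitivity (\int[nu \x m]_z F (cons_pair z)).
  have := @eq_weighted_integral _ _ _ _ _ _ _ (cons_measure nu m) (nu \x m)
    idfun (@cons_pair _ T n) (cst 1%R) (cst 1%R) F.
  rewrite (eq_integral F); last by move=> t _; rewrite mul1e.
  move=> ->//; first by apply: eq_integral => z _; rewrite mul1e.
  - exact: measurable_id.
  - move=> A mA; rewrite preimage_id.
    rewrite -[LHS]/(\int[cons_measure nu m]_(x in A) cst 1%E x).
    rewrite -[RHS]/(\int[nu \x m]_(x in @cons_pair _ T n @^-1` A) cst 1%E x).
    by rewrite !integral_cst//; exact: measurable_preimage.
  - by apply/measurable_EFinP; exact: mprod.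
  - by move=> t; rewrite lee_fin prodr_ge0.

pose G (t : n.-tuple T) := (\prod_(i < n) g (lift ord0 i) (tnth t i))%R.
have FE z : F (cons_pair z) = (g ord0 z.1 * G z.2)%:E.
  rewrite /F big_ord_recl tnth0; congr (_ * _)%:E.
  by apply: eq_bigr => i _; rewrite tnthS.
rewrite (eq_integral (fun z => (g ord0 z.1 * G z.2)%:E)); last by move=> z _.
have G0 t : (0 <= G t)%R by apply: prodr_ge0.
have mG : measurable_fun setT G.
  by apply: (mprod n (fun i => g (lift ord0 i))) => i; exact: mg.
rewrite (@fubini_tonelli1 _ _ _ _ _ nu m (fun z => (g ord0 z.1 * G z.2)%:E)); last 2 first.
- apply/measurable_EFinP; apply: measurable_funM.
    exact: (measurableT_comp (mg ord0) measurable_fst).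
  exact: (measurableT_comp mG measurable_snd).
- by move=> z; rewrite lee_fin mulr_ge0.
rewrite /fubini_F/= big_ord_recl -IH//.
rewrite -ge0_integralZr//; last 3 first.
- exact/measurable_EFinP.
- by move=> x _; rewrite lee_fin.
- by apply: integral_ge0 => t _; rewrite lee_fin; exact: prodr_ge0.
apply: eq_integral => x _; rewrite -/m -ge0_integralZl//.
- exact/measurable_EFinP.
- by move=> t _; rewrite lee_fin prodr_ge0.
- by rewrite lee_fin.
Qed.
End power_measure_integral.

Section positive_integral.
Local Open Scope ereal_scope.
Context d (T : measurableType d) (R : realType).

Lemma pos_integral_eq0 (mu : {measure set T -> \bar R}) (A : set T)
    (f : T -> \bar R) :
  measurable A -> measurable_fun A f -> (forall x, 0 < f x) ->
  \int[mu]_(x in A) f x = 0 -> mu A = 0.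
Proof.
move=> mA mf f0 If.
have : \int[mu]_(x in A) `|f x| = 0.
  by rewrite -If; apply: eq_integral => x _; rewrite gee0_abs// ltW.
move=> /(ae_eq_integral_abs _ mA mf)[N [mN N0 AN]].
apply: (subset_measure0 mA mN _ N0); apply: subset_trans AN => x Ax /=.
by move=> /(_ Ax) /eqP; rewrite gt_eqF.
Qed.

Variables (mu : {measure set T -> \bar R}) (f : T -> \bar R).
Hypotheses (mf : measurable_fun setT f) (f0 : forall x, 0 <= f x).

Definition density_measure (A : set T) := \int[mu]_(x in A) f x.

Let density0 : density_measure set0 = 0.
Proof. exact: integral_set0. Qed.

Let density_ge0 A : 0 <= density_measure A.
Proof. by apply: integral_ge0 => x _. Qed.

HB.instance Definition _ := isMeasure.Build _ _ _ density_measure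
  density0 density_ge0 (semi_sigma_additive_nng_induced mf f0).

Definition with_density : {measure set T -> \bar R} := density_measure.

End positive_integral.

Section mixture.
Local Open Scope ereal_scope.
Context d d' (T : measurableType d) (S : measurableType d') (R : realType).
Variables (P : probability T R) (nu : {sigma_finite_measure set S -> \bar R}).
Variables (n : nat) (k : 'I_n -> T * S -> R).
Hypotheses (mk : forall i, measurable_fun setT (k i)).
Hypotheses (k0 : forall i z, (0 < k i z)%R).

(** By Tonelli's theorem the mixture has on boxes, hence everywhere, the density
    g t = E [prod_i k i (w, t_i)] with respect to the product measure, and g is
    positive as the expectation of a positive variable. *)
Lemma mixture_dominates (law : {measure set (n.-tuple S) -> \bar R}) :
  law setT < +oo ->
  (forall A : 'I_n -> set S, (forall i, measurable (A i)) ->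
    law (box A) =
      \int[P]_w \prod_(i < n) \int[nu]_(y in A i) (k i (w, y))%:E) ->
  forall C, measurable C -> law C = 0 -> power_measure nu n C = 0.
Proof.
move=> lawoo lawbox C mC lawC.
set m := power_measure nu n.
pose K (z : T * n.-tuple S) := (\prod_(i < n) k i (z.1, tnth z.2 i))%R.
have mtnth i : measurable_fun setT (fun z : T * n.-tuple S => tnth z.2 i).
  exact: (measurableT_comp (measurable_tnth i) measurable_snd).
have K0 z : (0 < K z)%R by apply: prodr_gt0.
have mK : measurable_fun setT K.
  apply: measurable_fun_bigprod => i; apply: (measurableT_comp (mk i)).
  by apply: measurable_fun_pair; [exact: measurable_fst|exact: mtnth].
pose g t := \int[P]_w (K (w, t))%:E.
have mKt t : measurable_fun setT (fun w => (K (w, t))%:E).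
  apply/measurable_EFinP; apply: (measurableT_comp mK).
  exact: pair2_measurable.
have mg : measurable_fun setT g.
  apply: (@measurable_fun_fubini_tonelli_G _ _ _ _ _ P (EFin \o K)).
    exact/measurable_EFinP.
  by move=> z; rewrite lee_fin ltW.
have g0 t : 0 < g t.
  rewrite lt0e integral_ge0 ?andbT; last by move=> w _; rewrite lee_fin ltW.
  apply/eqP => g0; have : P setT = 0.
    by apply: (pos_integral_eq0 measurableT (mKt t)) => // w; rewrite lte_fin.
  by rewrite probability_setT => /eqP; rewrite onee_eq0.
have g_ge0 t : 0 <= g t by exact/ltW.
suff lawE : law C = with_density m mg g_ge0 C.
  move: lawC; rewrite lawE; apply: pos_integral_eq0 => //.
  exact: measurable_funTS.
apply: eq_measure_boxes => // A mA.
rewrite lawbox// [RHS]integral_mkcond.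
transitivity (\int[P]_w \int[m]_t (\prod_(i < n) (k i (w, tnth t i) * \1_(A i) (tnth t i)))%:E).
  apply: eq_integral => w _.
  rewrite (@integral_power_measure_prod _ _ _ nu n (fun i y => k i (w, y) * \1_(A i) y)%R).
  - apply: eq_bigr => i _; rewrite integral_mkcond; apply: eq_integral => y _.
    by rewrite patchE indicE; case: ifPn => _; rewrite ?mulr1 ?mulr0.
  - move=> i; apply: measurable_funM => //.
    by apply: (measurableT_comp (mk i)); exact: pair1_measurable.
  - by move=> i y; rewrite mulr_ge0// ltW.
rewrite (@fubini_tonelli _ _ _ _ _ P m (fun z =>
  (\prod_(i < n) (k i (z.1, tnth z.2 i) * \1_(A i) (tnth z.2 i)))%:E)).
- apply: eq_integral => t _; rewrite patchE; case: ifPn => At.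
    apply: eq_integral => w _; congr EFin; apply: eq_bigr => i _.
    by rewrite indicE mem_set ?mulr1//; move: At; rewrite inE; exact.
  have [i Ati] : exists i, ~ A i (tnth t i).
    by apply/existsNP => At'; move/negP: At; apply; rewrite inE.
  rewrite integral0_eq// => w _.
  by rewrite (bigD1 i)//= indicE memNset// mulr0 mul0r.
- apply/measurable_EFinP; apply: measurable_fun_bigprod => i.
  apply: measurable_funM; last first.
    by apply: (measurableT_comp _ (mtnth i)); exact: measurable_indic.
  apply: (measurableT_comp (mk i)).
  by apply: measurable_fun_pair => //; exact: measurable_fst.
- by move=> z; rewrite lee_fin; apply: prodr_ge0 => i _; rewrite mulr_ge0// ltW.
Qed.

End mixture.

(** * Null events of a generalized linear mixed model *)

Section glmm_support.
Local Open Scope ereal_scope.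
Context (R : realType) (p q N : nat) (Theta : set (param R p q)) (M : glmm Theta N).

(** Outside its domain D, h is arbitrary and may fail to be measurable. *)
Lemma C1_on_measurable (D : set R) (h : R -> R) :
  open D -> C1_on D h -> measurable_fun setT (h \_ D)%R.
Proof.
move=> oD hD; apply/(measurable_restrictT _ (open_measurable oD)).
apply: open_continuous_measurable_fun => // x /set_mem Dx.
by have [dh _] := hD x Dx; exact/differentiable_continuous/derivable1_diffP.
Qed.

(** Almost surely all natural parameters lie in the domain of the function b of
    the exponential family.  Replacing b by 0 outside that domain makes the
    conditional densities jointly measurable and positive everywhere, and does
    not affect the law of y. *)
Lemma glmm_law_dominates (theta : param R p q) (C : set (N.-tuple R)) :
  Theta theta -> measurable C ->
  glmm_prob M theta (glmm_y M @^-1` C) = 0 ->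
  power_measure (glmm_nu M) N C = 0.
Proof.
move=> Ttheta mC.
set P := glmm_prob M theta; set u := glmm_u M; set y := glmm_y M.
pose bXi := patch (cst 0%R) (glmm_Xi M) (glmm_b M).
have mu : measurable_fun setT u by [].
have [oXi _] := glmm_open M.
have mbXi : measurable_fun setT bXi.
  exact: (C1_on_measurable oXi (glmm_C1b (g := M))).
have mxi i : measurable_fun setT (fun w => glmm_xi i theta (u w)).
  by apply: (measurableT_comp _ mu); exact: glmm_xi_meas.
pose B := [set v : (glmm_dimu M).-tuple R | forall i, glmm_Xi M (glmm_xi i theta v)].
have mB : measurable B.
  rewrite (_ : B = \bigcap_(i in [set: 'I_N]) (glmm_xi i theta @^-1` glmm_Xi M)).
    apply: fin_bigcap_measurable; first exact: finite_finset.
    move=> i _; apply: measurable_preimage; first exact: glmm_xi_meas.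
    exact: open_measurable.
  by apply/seteqP; split => v /= h i => [_|]; apply: h.
have muB : measurable (u @^-1` B) by exact: measurable_preimage.
have PB : P (~` (u @^-1` B)) = 0.
  have [E [mE PE sE]] := glmm_linear_predictor M Ttheta.
  apply: (subset_measure0 (measurableC muB) mE _ PE) => w nB; apply: sE => /= h.
  by apply: nB => i; have [] := h i.
pose k (i : 'I_N) (z : glmm_space M * R) :=
  expfam_pdf (glmm_a M i) bXi (glmm_c M i) (par_phi theta)
    (glmm_xi i theta (u z.1)) z.2.
have mk i : measurable_fun setT (k i).
  have mx : measurable_fun setT
      (fun z : glmm_space M * R => glmm_xi i theta (u z.1)).
    exact: (measurableT_comp (mxi i) measurable_fst).
  have msnd : measurable_fun setT (fun z : glmm_space M * R => z.2).
    exact: measurable_snd.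
  apply: measurableT_comp => //; apply: measurable_funD.
    apply: measurable_funM => //; apply: measurable_funB.
      exact: measurable_funM.
    exact: (measurableT_comp mbXi mx).
  have mc : measurable_fun setT (fun t => glmm_c M i t (par_phi theta)).
    by apply: glmm_c_meas; exact: glmm_phi_dom.
  exact: (measurableT_comp mc msnd).
have k0 i z : (0 < k i z)%R by exact: expR_gt0.
move=> PC; have lawoo : distribution P y setT < +oo.
  by rewrite (le_lt_trans (probability_le1 _ _)) ?ltry.
apply: (mixture_dominates (P := P) mk k0 lawoo _ mC PC).
move=> A mA.
have mbox : measurable (y @^-1` box A).
  by apply: measurable_preimage => //; exact: measurable_box.
have lawE : distribution P y (box A) =
    P [set w | (forall i, A i (tnth (y w) i)) /\ B (u w)].
  rewrite -[RHS]/(P (y @^-1` box A `&` u @^-1` B)).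
  rewrite -[LHS]/(P (y @^-1` box A)) (measureDI P mbox muB).
  rewrite [X in X + _](_ : _ = 0) ?add0e//.
  apply: (subset_measure0 _ (measurableC muB) _ PB).
    exact: measurableD.
  by move=> w [].
apply: (etrans lawE); apply: (etrans (glmm_cond_indep Ttheta mA mB)).
pose F w := \prod_(i < N) \int[glmm_nu M]_(t in A i) (k i (w, t))%:E.
have F0 w : 0 <= F w.
  by apply: prode_ge0 => i _; apply: integral_ge0 => t _; rewrite lee_fin ltW.
have mF : measurable_fun setT F.
  rewrite /F; elim: (index_enum _) => [|i s IH].
    by under eq_fun do rewrite big_nil; exact: measurable_cst.
  under eq_fun do rewrite big_cons.
  apply: emeasurable_funM => //.
  pose h z := (k i z * \1_(A i) z.2)%:E.
  have mh : measurable_fun setT h.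
    apply/measurable_EFinP; apply: measurable_funM => //.
    by apply: (measurableT_comp _ measurable_snd); exact: measurable_indic.
  have h0 z : 0 <= h z by rewrite lee_fin mulr_ge0// ltW.
  apply: (eq_measurable_fun (fubini_F (glmm_nu M) h)).
    move=> w _; rewrite /fubini_F [RHS]integral_mkcond; apply: eq_integral => t _.
    by rewrite patchE /h indicE; case: ifPn => _; rewrite ?mulr1 ?mulr0.
  exact: measurable_fun_fubini_tonelli_F.
transitivity (\int[P]_(w in u @^-1` B) F w).
  apply: eq_integral => w; rewrite inE => Bw.
  apply: eq_bigr => i _; apply: eq_integral => t _; congr EFin.
  by rewrite /glmm_pdf /k /expfam_pdf /bXi patchE mem_set//; exact: Bw.
rewrite [RHS](ge0_negligible_integral (measurableC muB) measurableT mF _ PB)//.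
by rewrite setDE setTI setCK.
Qed.

Lemma glmm_null (theta0 theta : param R p q) (f : N.-tuple R -> R)
    (C : set (N.-tuple R)) :
  Theta theta0 -> Theta theta ->
  is_pdf (power_measure (glmm_nu M) N)
    (pushforward (glmm_prob M theta) (glmm_y M)) f ->
  measurable C ->
  glmm_prob M theta0 (glmm_y M @^-1` C) = 0 ->
  glmm_prob M theta (glmm_y M @^-1` C) = 0.
Proof.
move=> T0 T1 [mf f0 fE] mC P0; apply: (etrans (fE _ mC)).
have nuC := glmm_law_dominates T0 mC P0.
rewrite -(@integral_abs_eq0 _ _ _ (power_measure (glmm_nu M) N) C (EFin \o f))//.
- by apply: eq_integral => t _; rewrite gee0_abs// lee_fin.
- by apply/measurable_EFinP; exact: measurable_funTS.
Qed.

End glmm_support.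

(** * Likelihood ratios *)

(** Away from the zeros of f, the inverse is expR (- ln (f t)). *)
Lemma measurable_fun_ge0V d (T : measurableType d) (R : realType) (f : T -> R) :
  measurable_fun setT f -> (forall t, 0 <= f t) ->
  measurable_fun setT (fun t => (f t)^-1).
Proof.
move=> mf f0; pose Z := f @^-1` [set 0%R].
have mZ : measurable Z by exact: measurable_preimage.
apply: (eq_measurable_fun (fun t => expR (- ln (f t)) * \1_(~` Z) t)).
  move=> t _; rewrite indicE; have [ft|ft] := eqVneq (f t) 0%R.
    by rewrite memNset ?mulr0 ?ft ?invr0//; exact.
  rewrite mem_set ?mulr1; last by move=> Zt; rewrite Zt eqxx in ft.
  by rewrite expRN lnK// posrE lt_neqAle f0 andbT eq_sym.
apply: measurable_funM; last by apply: measurable_indic; exact: measurableC.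
by do 2 apply: measurableT_comp => //; exact: measurableT_comp.
Qed.

Section likelihood_ratio.
Local Open Scope ereal_scope.
Context d (T : measurableType d) (R : realType).

Lemma pdf_integral1 d' (E : measurableType d') (P : probability T R)
    (X : T -> E) (nu : {measure set E -> \bar R}) (f : E -> R) :
  is_pdf nu (pushforward P X) f -> \int[nu]_t (f t)%:E = 1.
Proof.
move=> [_ _ fE]; rewrite -(fE setT)//.
by rewrite /pushforward preimage_setT probability_setT.
Qed.

(** Where f0 is positive, f times the integrand is at most f0, which integrates
    to 1.  Where f0 vanishes, the integrand is 1 by the convention on ln; the
    absolute continuity hypothesis discards this set. *)
Lemma integral_inverse_ratio_le1 d' (E : measurableType d')
    (P P0 : probability T R) (X : T -> E) (nu : {measure set E -> \bar R})
    (f f0 : E -> R) :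
  measurable_fun setT X ->
  is_pdf nu (pushforward P X) f -> is_pdf nu (pushforward P0 X) f0 ->
  (forall A, measurable A -> P0 (X @^-1` A) = 0 -> P (X @^-1` A) = 0) ->
  \int[P]_w (expR (- ln (f (X w) / f0 (X w))))%:E <= 1.
Proof.
move=> mX pf pf0 ac.
have [mf f_ge0 fE] := pf; have [mf0 f0_ge0 f0E] := pf0.
pose Z := f0 @^-1` [set 0%R].
have mZ : measurable Z by exact: measurable_preimage.
have PZ : P (X @^-1` Z) = 0.
  apply: ac => //; rewrite -[LHS]/(pushforward P0 X Z) f0E//.
  by rewrite integral0_eq// => t ->.
pose g t := expR (- ln (f t / f0 t)).
have mg : measurable_fun setT g.
  apply: measurableT_comp => //; apply: measurableT_comp => //.
  apply: measurableT_comp => //; apply: measurable_funM => //.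
  exact: measurable_fun_ge0V.
pose h t := (g t * \1_(~` Z) t)%:E.
have h0 t : 0 <= h t by rewrite lee_fin mulr_ge0// expR_ge0.
have mh : measurable_fun setT h.
  apply/measurable_EFinP; apply: measurable_funM => //; apply: measurable_indic.
  exact: measurableC.
have mXZ : measurable (X @^-1` Z) by exact: measurable_preimage.
have mgX : measurable_fun setT (fun w => (g (X w))%:E).
  by apply/measurable_EFinP; exact: (measurableT_comp mg mX).
rewrite (ge0_negligible_integral mXZ measurableT mgX _ PZ); last first.
  by move=> w _; rewrite lee_fin expR_ge0.
have -> : \int[P]_(w in setT `\` X @^-1` Z) (g (X w))%:E = \int[P]_w h (X w).
  rewrite integral_mkcond; apply: eq_integral => w _.
  rewrite patchE /h setTD indicE.
  have -> : (w \in ~` (X @^-1` Z)) = (X w \in ~` Z) by apply/idP/idP; rewrite !inE.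
  by case: ifPn => _; rewrite ?mulr1 ?mulr0.
rewrite (integral_pdf mX pf mh h0) -(pdf_integral1 pf0).
apply: ge0_le_integral => //.
- by move=> t _; rewrite mule_ge0// lee_fin.
- by apply: emeasurable_funM => //; exact/measurable_EFinP.
- exact/measurable_EFinP.
move=> t _; rewrite /h -EFinM lee_fin indicE.
have [Zt|nZt] := pselect (Z t); first by rewrite memNset ?mulr0 ?mulr0//; exact.
rewrite mem_set// mulr1 /g.
have f0t : (0 < f0 t)%R by rewrite lt_neqAle f0_ge0 andbT eq_sym; apply/eqP.
have [->|ft] := eqVneq (f t) 0%R; first by rewrite mul0r.
have ftp : (0 < f t)%R by rewrite lt_neqAle f_ge0 andbT eq_sym.
by rewrite expRN lnK ?posrE ?divr_gt0// invf_div mulrCA mulfV// mulr1.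
Qed.

(** Markov's inequality for exp of minus the sum, whose expectation is a product
    of factors at most 1. *)
Lemma independent_chernoff (I : finType) d' (E : I -> measurableType d')
    (P : probability T R) (X : forall i, T -> E i) (z : forall i, E i -> R)
    (c : R) :
  (forall i, measurable_fun setT (X i)) -> mutually_independent P X ->
  (forall i, measurable_fun setT (z i)) ->
  (forall i, \int[P]_w (expR (- z i (X i w)))%:E <= 1) ->
  P [set w | \sum_i z i (X i w) <= - c]%R <= (expR (- c))%:E.
Proof.
move=> mX indX mz z1.
have mzX i : measurable_fun setT (fun w => z i (X i w)).
  exact: (measurableT_comp (mz i) (mX i)).
have mS : measurable_fun setT (fun w => \sum_i z i (X i w))%R.
  exact: measurable_sum.
pose B := [set w | \sum_i z i (X i w) <= - c]%R.
have mB : measurable B.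
  rewrite [X in measurable X](_ : _ =
      (fun w => \sum_i z i (X i w))%R @^-1` `]-oo, (- c)%R]%classic).
    exact: measurable_preimage.
  by apply/seteqP; split=> w /=; rewrite in_itv.
have mg i : measurable_fun setT (fun t => expR (- z i t)).
  by apply: measurableT_comp => //; apply: measurableT_comp => //; exact: mz.
have Pi : \int[P]_w (\prod_i expR (- z i (X i w)))%:E <= 1.
  rewrite (@independent_integral_prod _ _ _ _ _ _ _ _ mX indX
    (fun i t => expR (- z i t)))//.
  - suff /andP[] : 0 <= \prod_i \int[P]_w (expR (- z i (X i w)))%:E <= 1 by [].
    elim/big_ind : _ => [|x y /andP[x0 x1] /andP[y0 y1]|i _].
    + by rewrite lee01 lexx.
    + by rewrite mule_ge0//= -[leRHS]mule1 lee_pmul.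
    + by rewrite z1 andbT integral_ge0// => w _; rewrite lee_fin expR_ge0.
  - by move=> i; exact: le_lt_trans (z1 i) (ltry 1).
rewrite -/B expRN -[(_^-1)%R]mul1r EFinM lee_pdivlMr ?expR_gt0//; apply: le_trans Pi.
rewrite -[B]setIT -integral_indic// -ge0_integralZr//; last first.
  by apply/measurable_EFinP; exact: measurable_indic.
apply: ge0_le_integral => //.
- by apply: emeasurable_funM => //; apply/measurable_EFinP; exact: measurable_indic.
- apply/measurable_EFinP; apply: measurable_fun_bigprod => i.
  exact: (measurableT_comp (mg i) (mX i)).
move=> w _; rewrite -EFinM lee_fin indicE -expR_sum sumrN.
have [Bw|Bw] := pselect (B w); last by rewrite memNset// mul0r expR_ge0.
by rewrite mem_set// mul1r ler_expR lerNr.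
Qed.

(** On the event in question the density f0 is dominated by f; this trades P0
    for P in the study of the maximizer of the likelihood. *)
Lemma likelihood_order_prob_le d' (E : measurableType d')
    (P P0 : probability T R) (X : T -> E) (nu : {measure set E -> \bar R})
    (f f0 : E -> R) (A : set E) :
  is_pdf nu (pushforward P X) f -> is_pdf nu (pushforward P0 X) f0 ->
  measurable A ->
  P0 (X @^-1` (A `&` [set t | f0 t <= f t]%R)) <= P (X @^-1` A).
Proof.
move=> [mf f_ge0 fE] [mf0 f0_ge0 f0E] mA.
have mB : measurable (A `&` [set t | f0 t <= f t]%R).
  apply: measurableI => //; rewrite -[X in measurable X]setTI.
  exact: measurable_fun_le.
rewrite -[leLHS]/(pushforward P0 X _) f0E// -[leRHS]/(pushforward P X A) fE//.
apply: (@le_trans _ _ (\int[nu]_(t in A `&` [set t | f0 t <= f t]%R) (f t)%:E)).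
  apply: ge0_le_integral => //.
  - by move=> t _; rewrite lee_fin.
  - by apply/measurable_EFinP; exact: measurable_funTS.
  - by apply/measurable_EFinP; exact: measurable_funTS.
  - by move=> t [_ ft]; rewrite lee_fin.
apply: ge0_subset_integral => //.
- by apply/measurable_EFinP; exact: measurable_funTS.
- by move=> t _; rewrite lee_fin.
Qed.

End likelihood_ratio.

(** * The bound for a fixed sample size *)

Section cluster_bound.
Local Open Scope ereal_scope.
Context (R : realType) (p q N : nat) (Theta : set (param R p q)).
Variables (M : glmm Theta N) (C : clustering N).

Definition cl_proj (j : 'I_(cl_count C)) (t : N.-tuple R) : (cl_dim j).-tuple R :=
  [tuple tnth t (cl_index (enum_val k)) | k < cl_dim j].

Lemma measurable_cl_proj j : measurable_fun setT (cl_proj j).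
Proof.
apply/measurable_fun_tnthP => k.
rewrite (_ : _ \o _ = (@tnth N R)^~ (cl_index (enum_val k))).
  exact: measurable_tnth.
by apply/funext => t /=; rewrite tnth_mktuple.
Qed.

Lemma measurable_cl_y j : measurable_fun setT (cl_y (C := C) M j).
Proof.
have my : measurable_fun setT (glmm_y M) by [].
exact: (measurableT_comp (@measurable_cl_proj j) my).
Qed.

Variables (theta0 theta : param R p q) (f : param R p q -> N.-tuple R -> R).
Variable fc : forall j : 'I_(cl_count C), param R p q -> (cl_dim j).-tuple R -> R.
Hypotheses (T0 : Theta theta0) (T1 : Theta theta).
Hypothesis f_pdf : forall th, Theta th ->
  is_pdf (power_measure (glmm_nu M) N)
    (pushforward (glmm_prob M th) (glmm_y M)) (f th).
Hypothesis fc_pdf : forall j th, Theta th ->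
  is_pdf (power_measure (glmm_nu M) (cl_dim j))
    (pushforward (glmm_prob M th) (cl_y M j)) (@fc j th).
Hypothesis indep : forall th, Theta th ->
  mutually_independent (glmm_prob M th) (fun j => cl_y M (C := C) j).

Let P0 := glmm_prob M theta0.
Let P1 := glmm_prob M theta.
Let z j (t : (cl_dim j).-tuple R) := ln (fc theta t / fc theta0 t).

(** The event is split according to whether the cluster log-ratios sum to at
    most - eta m.  If not, Chebyshev's inequality under theta0 applies; if so,
    the probability is transferred to theta and the exponential bound applies
    there. *)
Lemma likelihood_order_bound (eta : R) :
  (0 < cl_count C)%N -> (0 < eta)%R ->
  (forall j, 'V_P0[cl_log_ratio M (@fc) theta theta0 j] < +oo) ->
  ((cl_count C)%:R^-1)%:E *
    \sum_(j < cl_count C) 'E_P0[cl_log_ratio M (@fc) theta theta0 j]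
    <= (- (2 * eta))%:E ->
  P0 (glmm_y M @^-1` [set t | f theta0 t <= f theta t]%R) <=
  (eta ^- 2)%:E * ((((cl_count C)%:R ^+ 2)^-1)%:E *
     \sum_(j < cl_count C) 'V_P0[cl_log_ratio M (@fc) theta theta0 j]) +
  (expR (- (eta * (cl_count C)%:R)))%:E.
Proof.
move=> m0 eta0 Vfin Emean.
have mz j : measurable_fun setT (@z j).
  have [mf _ _] := fc_pdf j T1; have [mf0 f0_ge0 _] := fc_pdf j T0.
  apply: measurableT_comp => //; apply: measurable_funM => //.
  exact: measurable_fun_ge0V.
have mZ j : measurable_fun setT (cl_log_ratio M (@fc) theta theta0 j).
  exact: (measurableT_comp (mz j) (@measurable_cl_y j)).
have Z2 j := variance_lty_Lfun2 (mZ j) (Vfin j).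
have Z0 i j : i != j ->
    covariance P0 (cl_log_ratio M (@fc) theta theta0 i) (cl_log_ratio M (@fc) theta theta0 j) = 0.
  move=> ij.
  pose U k : {RV P0 >-> R} := mfun_Sub (mem_set (mZ k)).
  apply: (@independent_covariance0 _ _ _ _ (U i) (U j) (Z2 i) (Z2 j)) => A B mA mB.
  apply: (mutually_independent_pair (indep T0) ij (A := @z i @^-1` A) (B := @z j @^-1` B)).
    exact: (measurable_preimage (@mz i) mA).
  exact: (measurable_preimage (@mz j) mB).
have dev := sum_deviation m0 eta0 Z2 Z0 Emean.
pose S t := (\sum_(j < cl_count C) z (cl_proj j t))%R.
have mS : measurable_fun setT S.
  apply: measurable_sum => j.
  exact: (measurableT_comp (mz j) (@measurable_cl_proj j)).
set c := (eta * (cl_count C)%:R)%R in dev *.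
pose D := [set t | S t <= - c]%R.
have mD : measurable D.
  rewrite (_ : D = S @^-1` `]-oo, (- c)%R]%classic); first exact: measurable_preimage.
  by apply/seteqP; split=> t /=; rewrite in_itv.
have dom : forall A, measurable A -> P0 (glmm_y M @^-1` A) = 0 -> P1 (glmm_y M @^-1` A) = 0.
  by move=> A mA; exact: (glmm_null T0 T1 (f_pdf T1) mA).
have chern : P1 (glmm_y M @^-1` D) <= (expR (- c))%:E.
  have h := @independent_chernoff _ _ _ _ _ _ P1 _ _ c measurable_cl_y (indep T1) mz.
  apply: h => j.
  apply: (integral_inverse_ratio_le1 (@measurable_cl_y j) (fc_pdf j T1) (fc_pdf j T0)).
  move=> A mA; apply: (dom (cl_proj j @^-1` A)).
  by apply: measurable_preimage => //; exact: measurable_cl_proj.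
pose L := [set t | f theta0 t <= f theta t]%R.
have mL : measurable L.
  rewrite -[X in measurable X]setTI; apply: measurable_fun_le => //.
    by have [] := f_pdf T0.
  by have [] := f_pdf T1.
have my : measurable_fun setT (glmm_y M) by [].
have order := likelihood_order_prob_le (f_pdf T1) (f_pdf T0) mD.
have mpre A : measurable A -> measurable (glmm_y M @^-1` A) by exact: measurable_preimage.
rewrite (measureDI _ (mpre _ mL) (mpre _ mD)) leeD//.
  apply: le_trans dev; apply: le_measure; rewrite ?inE.
  - by apply: measurableD; exact: mpre.
  - rewrite (_ : [set w | _] = glmm_y M @^-1` (S @^-1` `](- c)%R, +oo[%classic)).
      by apply/mpre/measurable_preimage.
    by apply/seteqP; split=> w /=; rewrite in_itv/= andbT.
  - by move=> w [_ /=] /negP; rewrite -ltNge.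
apply: le_trans chern; apply: le_trans order; apply: le_measure; rewrite ?inE.
- by apply: measurableI; exact: mpre.
- by apply: mpre; exact: measurableI.
- by move=> w [].
Qed.

End cluster_bound.

(** * Consistency *)

Section limits.
Local Open Scope ereal_scope.
Context (R : realType).

Lemma bigmine_lt0 n (x : 'I_n -> \bar R) :
  \big[mine/+oo]_(i < n) x i < 0 -> exists i, x i < 0.
Proof.
move=> h; apply: contrapT => nx; move: h; rewrite ltNge => /negP; apply.
elim/big_ind : _ => [|y z y0 z0|i _]; first exact: leey.
  by rewrite le_min y0 z0.
by rewrite leNgt; apply/negP => xi; apply: nx; exists i.
Qed.

Lemma limn_esup_lt0 (u : (\bar R)^nat) : limn_esup u < 0 ->
  exists2 eta : R, (0 < eta)%R & \forall n \near \oo, u n <= (- (2 * eta))%:E.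
Proof.
move=> /ereal_inf_lt[_ [V oV <-]] Vlt0.
have uV n : V n -> u n <= ereal_sup (u @` V).
  by move=> Vn; apply: ereal_sup_ubound; exists n.
case E : (ereal_sup _) => [r| |] in Vlt0 uV.
- exists (- r / 2)%R; first by move: Vlt0; rewrite lte_fin => r0; lra.
  apply: filterS oV => n /uV; congr (_ <= _%:E); lra.
- by [].
- exists 1%R => //; apply: filterS oV => n /uV; rewrite leeNy_eq => /eqP ->.
  exact: leNye.
Qed.

Lemma sum_variance_lty n (c : R) (v : 'I_n -> \bar R) :
  (0 < c)%R -> (forall j, 0 <= v j) -> c%:E * \sum_(j < n) v j < +oo ->
  forall j, v j < +oo.
Proof.
move=> c0 v0 + j => clt; rewrite ltey; apply/eqP => vj; move: clt.
rewrite (bigD1 j)//= vj addye; last first.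
  by rewrite gt_eqF// (lt_le_trans ltNy0)// sume_ge0.
by rewrite gt0_muley ?lte_fin// ltxx.
Qed.

Lemma cvg_expR_count (eta : R) (m : nat -> nat) : (0 < eta)%R ->
  m @ \oo --> \oo -> (fun N => (expR (- (eta * (m N)%:R)))%:E) @ \oo --> 0.
Proof.
move=> eta0 moo.
suff h : (fun n => expR (- (eta * n%:R)))%R @ \oo --> (0%R : R).
  by apply: cvg_EFin; [exact: nearW|exact: cvg_comp moo h].
under eq_cvg do rewrite -mulNr expRM_natr.
by apply: cvg_expr; rewrite ger0_norm ?expR_ge0// expR_lt1 oppr_lt0.
Qed.

End limits.

Theorem theorem3 (R : realType) (p q b : nat)
    (Theta : set (param R p q)) (theta0 : param R p q)
    (M : forall N : nat, glmm Theta N)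
    (D : forall N : nat, 'I_b -> clustering N)
    (f : forall N : nat, param R p q -> N.-tuple R -> R)
    (fc : forall (N : nat) (a : 'I_b) (j : 'I_(cl_count (D N a))),
       param R p q -> (cl_dim j).-tuple R -> R)
    (mle : forall N : nat, N.-tuple R -> param R p q)
    (b_gt0 : (0 < b)%N)
    (Theta_finite : finite_set Theta)
    (Theta0 : Theta theta0)
    (f_pdf : forall (N : nat) (theta : param R p q), Theta theta ->
       is_pdf (power_measure (glmm_nu (M N)) N)
              (pushforward (glmm_prob (M N) theta) (glmm_y (M N)))
              (f N theta))
    (fc_pdf : forall (N : nat) (a : 'I_b) (j : 'I_(cl_count (D N a)))
         (theta : param R p q), Theta theta ->
       is_pdf (power_measure (glmm_nu (M N)) (cl_dim j))
              (pushforward (glmm_prob (M N) theta) (cl_y (M N) j))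
              (fc N a j theta))
    (A1_indep : forall (N : nat) (a : 'I_b) (theta : param R p q),
       Theta theta ->
       mutually_independent (glmm_prob (M N) theta)
         (fun j : 'I_(cl_count (D N a)) => cl_y (M N) j))
    (A1_count : forall a : 'I_b, (fun N => cl_count (D N a)) @ \oo --> \oo)
    (A2 : forall theta : param R p q, Theta theta -> theta <> theta0 ->
       (\big[mine/+oo]_(a < b)
          limn_esup (fun N => ((cl_count (D N a))%:R^-1)%:E *
            \sum_(j < cl_count (D N a))
              'E_(glmm_prob (M N) theta0)
                [cl_log_ratio (M N) (fc N a) theta theta0 j]) < 0)%E)
    (A3 : forall (theta : param R p q) (a : 'I_b),
       Theta theta -> theta <> theta0 ->
       (fun N => (((cl_count (D N a))%:R ^+ 2)^-1)%:E *
            \sum_(j < cl_count (D N a))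
              'V_(glmm_prob (M N) theta0)
                [cl_log_ratio (M N) (fc N a) theta theta0 j])%E
         @ \oo --> 0%E)
    (mleP : forall N : nat, is_mle Theta (f N) (mle N)) :
  (fun N => glmm_prob (M N) theta0 [set w | mle N (glmm_y (M N) w) = theta0])
    @ \oo --> 1%E.
Proof.
pose P N := glmm_prob (M N) theta0.
pose Y N := glmm_y (M N).
pose bad N theta := Y N @^-1` [set t | mle N t = theta].
have my N : measurable_fun setT (Y N) by [].
have mbad N theta : Theta theta -> measurable (bad N theta).
  move=> Ttheta; apply: measurable_preimage => //.
  by have [_] := mleP N; exact.
have bad0 theta : Theta theta -> theta <> theta0 ->
    (fun N => P N (bad N theta)) @ \oo --> 0%E.
  move=> Ttheta neq.
  (* this subset of the data separates theta from theta0 *)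
  have [a /limn_esup_lt0[eta eta0 Emean]] := bigmine_lt0 (A2 _ Ttheta neq).
  have V0 := A3 _ a Ttheta neq.
  pose V N := ((((cl_count (D N a))%:R ^+ 2)^-1)%:E *
            \sum_(j < cl_count (D N a))
              'V_(glmm_prob (M N) theta0)
                [cl_log_ratio (M N) (fc N a) theta theta0 j])%E.
  pose e N := (expR (- (eta * (cl_count (D N a))%:R)))%:E.
  have e0 : e @ \oo --> 0%E := cvg_expR_count eta0 (A1_count a).
  have bound0 : (fun N => (eta ^- 2)%:E * V N + e N)%E @ \oo --> 0%E.
    rewrite -[X in _ --> X](_ : (eta ^- 2)%:E * 0 + 0 = 0)%E; last first.
      by rewrite mule0 adde0.
    by apply: cvgeD => //; exact: cvgeZl.
  apply: (squeeze_cvge _ (cvg_cst 0%E) bound0).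
  near=> N; rewrite measure_ge0/=.
  have m0 : (0 < cl_count (D N a))%N.
    near: N; exact: (A1_count a) (nbhs_infty_gt 0).
  have c0 : (0 < ((cl_count (D N a))%:R ^+ 2)^-1 :> R).
    by rewrite invr_gt0 exprn_gt0// ltr0n.
  have VN : (V N < +oo)%E.
    suff /fin_numPlt/andP[] : V N \is a fin_num by [].
    by near: N; have /fine_cvgP[] := V0.
  apply: le_trans (likelihood_order_bound Theta0 Ttheta (f_pdf N) (fc_pdf N a)
    (A1_indep N a) m0 eta0 _ _).
  - apply: le_measure; rewrite ?inE.
    + exact: mbad.
    + apply: measurable_preimage => //.
      rewrite -[X in measurable X]setTI; apply: measurable_fun_le => //.
        by have [] := f_pdf N _ Theta0.
      by have [] := f_pdf N _ Ttheta.
    + move=> w /= <-; have [h _] := mleP N; exact: (h _).2.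
  - apply: (sum_variance_lty c0 _ VN) => j; exact: variance_ge0.
  - by near: N.
have /finite_seqP[s sE] := Theta_finite.
have inTheta theta : theta \in s -> Theta theta by move=> ts; rewrite sE.
(* the errors are gathered one wrong parameter at a time *)
pose wrong N (s : seq (param R p q)) := [set w | mle N (Y N w) \in s].
have wrong_cons N x r : wrong N (x :: r) = bad N x `|` wrong N r.
  apply/seteqP; split => w /=; rewrite /wrong/= inE; first by case/orP => [/eqP|]; [left|right].
  by case=> [->|->]; rewrite ?eqxx ?orbT.
have wrong0 r : (forall theta, theta \in r -> Theta theta /\ theta <> theta0) ->
    (forall N, measurable (wrong N r)) /\ (fun N => P N (wrong N r)) @ \oo --> 0%E.
  elim: r => [_|x r IH xr].
    have E N : wrong N [::] = set0 by apply/seteqP; split.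
    split; first by move=> N; rewrite E.
    rewrite (_ : (fun N => _) = fun=> 0%E); first exact: cvg_cst.
    by apply/funext => N; rewrite E measure0.
  have [Tx nx] := xr x (mem_head _ _).
  have [|mr r0] := IH; first by move=> theta tr; apply: xr; rewrite inE tr orbT.
  split; first by move=> N; rewrite wrong_cons; apply: measurableU => //; exact: mbad.
  have sum0 : (fun N => P N (bad N x) + P N (wrong N r))%E @ \oo --> 0%E.
    by rewrite -[X in _ --> X](adde0 0%E); apply: cvgeD => //; exact: bad0.
  apply: (squeeze_cvge _ (cvg_cst 0%E) sum0); apply: nearW => N.
  by rewrite measure_ge0 wrong_cons/= measureU2//; exact: mbad.
pose r := [seq theta <- s | theta != theta0].
have [|mr r0] := wrong0 r.
  by move=> theta; rewrite mem_filter => /andP[/eqP nt ts]; split=> //; exact: inTheta.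
have good N : P N [set w | mle N (Y N w) = theta0] = (1 - P N (wrong N r))%E.
  rewrite -probability_setC//; congr (P N _); apply/seteqP; split => w /=.
    by move=> mt; rewrite /wrong/= mt mem_filter eqxx.
  rewrite /wrong/= mem_filter => /negP; rewrite negb_and negbK.
  case/orP => [/eqP//|]; have [h _] := mleP N.
  by have [+ _] := h (Y N w); rewrite {1}sE/= => ->.
rewrite (_ : (fun N => _) = fun N => (1 - P N (wrong N r))%E); last first.
  by apply/funext => N; exact: good.
rewrite -[X in _ --> X](sube0 1%E); apply: cvgeB => //; exact: cvg_cst.
Unshelve. all: by end_near.
Qed.
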